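(* Let $v_0\in\mathbb{R}^k$ and let $C=v_0+\operatorname{pos}(\varepsilon_1,\dots,\varepsilon_k)\subset\mathbb{R}^k$ be a $k$-dimensional simplicial cone with apex $v_0$ and extremal rays generated by $\varepsilon_1,\dots,\varepsilon_k\in\mathbb{R}^k$. Assume that the origin $\mathbb{0}$ lies in the interior of $C$. For $j\in[k]$ put $$q_j=(-1)^{j-1}\,\varepsilon_1\times\cdots\times\widehat{\varepsilon}_j\times\cdots\times\varepsilon_k,\qquad \tilde q_j=\frac{1}{\langle v_0,q_j\rangle}\,q_j ,$$ so that $C=\{v\in\mathbb{R}^k\mid \langle v,\tilde q_j\rangle\le\langle v_0,\tilde q_j\rangle\text{ for all } j\in[k]\}$ and the polar dual of $C$ is $C^*=\operatorname{conv}(\{\mathbb{0}\}\cup\{\tilde q_j\mid j\in[k]\})$. For $0\le m<k$ let $I\subset[k]$ with $|I|=m$, let $J=[k]\setminus I$ and $\ell=|J|$. Define the $(m+1)$-simplex $S_I\subset C$ and the $(\ell-1)$-simplex $\Delta_J\subset C^*$ by $$S_I=\operatorname{conv}\big(\{\mathbb{0},v_0\}\cup\{v_0+\varepsilon_i\mid i\in I\}\big),\qquad \Delta_J=\operatorname{conv}\big(\{\tilde q_j\mid j\in J\}\big).$$ Then $$\frac{\operatorname{vol}_{\ell-1}(\Delta_J)}{\operatorname{vol}_{m+1}(S_I)}=\frac{(m+1)!}{(\ell-1)!}\cdot\frac{\operatorname{vol}_k(\mathcal{E})^{\ell-1}}{\prod_{j\in J}|\langle v_0,q_j\rangle|},$$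 where $\mathcal{E}$ is the $k$-dimensional parallelepiped spanned by $\varepsilon_1,\dots,\varepsilon_k$.
   Context: $[k]=\{1,\dots,k\}$. $\operatorname{pos}(\varepsilon_1,\dots,\varepsilon_k)=\{\sum_i\mu_i\varepsilon_i\mid \mu_i\ge0\}$; the cone being $k$-dimensional and simplicial means $\varepsilon_1,\dots,\varepsilon_k$ are linearly independent. $\operatorname{conv}$ is the convex hull. For a polyhedron $C$ containing the origin in its interior, the polar dual is $C^*=\{p\in\mathbb{R}^k\mid\langle p,v\rangle\le1\text{ for all }v\in C\}$. The generalized vector product $u_1\times\cdots\times u_{k-1}\in\mathbb{R}^k$ is the multilinear product determined by $\langle x,u_1\times\cdots\times u_{k-1}\rangle=\det(x,u_1,\dots,u_{k-1})$ for all $x\in\mathbb{R}^k$; $\widehat{\varepsilon}_j$ means that the factor is omitted. Thus $\langle q_i,\varepsilon_j\rangle=\det(\varepsilon_1,\dots,\varepsilon_k)\,\delta_{ij}$. $\operatorname{vol}_d$ is $d$-dimensional Euclidean volume, with $\operatorname{vol}_0$ of a point equal to $1$. *)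

(* Defs.v *)
From mathcomp Require Import all_boot all_order all_algebra.
From mathcomp Require Import all_classical all_reals all_analysis.
From mathcomp Require Import measurable_realfun.
Set Implicit Arguments.
Unset Strict Implicit.
Unset Printing Implicit Defensive.
Import Order.TTheory GRing.Theory Num.Theory numFieldNormedType.Exports.
Local Open Scope classical_set_scope.
Local Open Scope ring_scope.

Definition dotp (R : realType) (k : nat) (u v : 'rV[R]_k) : R :=
  \sum_(i < k) u 0 i * v 0 i.

Definition pos_hull (R : realType) (k r : nat) (e : 'I_r -> 'rV[R]_k) :
    set 'rV[R]_k :=
  [set p | exists mu : 'I_r -> R,
    (forall i, 0 <= mu i) /\ p = \sum_i mu i *: e i].

Definition cone (R : realType) (k r : nat) (v0 : 'rV[R]_k)
    (e : 'I_r -> 'rV[R]_k) : set 'rV[R]_k :=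
  [set v0 + p | p in pos_hull e].

Definition parallelepiped (R : realType) (k r : nat) (e : 'I_r -> 'rV[R]_k) :
    set 'rV[R]_k :=
  [set p | exists t : 'I_r -> R,
    (forall i, 0 <= t i <= 1) /\ p = \sum_i t i *: e i].

Definition convex_hull (R : realType) (k : nat) (A : set 'rV[R]_k) :
    set 'rV[R]_k :=
  smallest (@convex_set R 'rV[R]_k) A.

Definition polar_dual (R : realType) (k : nat) (C : set 'rV[R]_k) :
    set 'rV[R]_k :=
  [set p | forall v, C v -> dotp p v <= 1].

Definition affinely_independent (R : realType) (k r : nat)
    (p : 'I_r -> 'rV[R]_k) : Prop :=
  forall c : 'I_r -> R, \sum_i c i = 0 -> \sum_i c i *: p i = 0 ->
    forall i, c i = 0.

Definition is_simplex (R : realType) (k d : nat) (S : set 'rV[R]_k) : Prop :=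
  exists p : 'I_d.+1 -> 'rV[R]_k,
    affinely_independent p /\ S = convex_hull (range p).

(* The factors u_1, ..., u_n are the rows of U; the i-th coordinate of the
   product is det(e_i, u_1, ..., u_n), see dotp_cross and cross_unique. *)
Definition cross (R : realType) (n : nat) (U : 'M[R]_(n, n.+1)) :
    'rV[R]_n.+1 :=
  \row_i \det (col_mx (delta_mx 0 i : 'rV[R]_n.+1) U : 'M[R]_n.+1).

(* Indices start at 0, so the sign (-1)^(j-1) becomes (-1)^j. *)
Definition facet_normal (R : realType) (n : nat)
    (e : 'I_n.+1 -> 'rV[R]_n.+1) (j : 'I_n.+1) : 'rV[R]_n.+1 :=
  (-1) ^+ j *: cross (row' j (\matrix_i e i)).

(* Lebesgue measure of a Borel subset of R^d, as the iterated product measure: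
   the successor case is the library's product measure of lebesgue_measure and
   the d-dimensional measure, i.e. the integral of the measures of the sections
   (cf. product_measure1). See lebesgue_rV_box for the value on boxes. *)
Fixpoint lebesgue_rV (R : realType) (d : nat) : set 'rV[R]_d -> \bar R :=
  match d return set 'rV[R]_d -> \bar R with
  | 0 => fun A => (\1_A (0 : 'rV[R]_0))%:E
  | d'.+1 => fun A =>
      (\int[lebesgue_measure]_(x in [set: R])
         lebesgue_rV [set y : 'rV[R]_d' | A (row_mx (x%:M : 'rV[R]_1) y)])%E
  end.

(* d-dimensional volume of S in R^k: the Lebesgue measure of S in Cartesian
   coordinates x |-> p + x B, with orthonormal directions the rows of B, on a
   d-dimensional affine subspace containing S. All choices of (p, B) give the
   same value for Borel S, so the infimum is only a way of not choosing one
   (the value is +oo if S lies in no d-dimensional affine subspace). *)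
Definition vol (R : realType) (k d : nat) (S : set 'rV[R]_k) : \bar R :=
  ereal_inf [set a | exists (p : 'rV[R]_k) (B : 'M[R]_(d, k)),
    [/\ B *m B^T = 1%:M,
        S `<=` range (fun x : 'rV[R]_d => p + x *m B) &
        a = lebesgue_rV [set x : 'rV[R]_d | S (p + x *m B)]]].

Lemma dotp_cross (R : realType) (n : nat) (U : 'M[R]_(n, n.+1))
    (x : 'rV[R]_n.+1) :
  dotp x (cross U) = \det (col_mx x U : 'M[R]_n.+1).
Proof.
have top (y : 'rV[R]_n.+1) i : (col_mx y U : 'M[R]_n.+1) ord0 i = y 0 i.
  by rewrite mxE; case: splitP => // j _; rewrite ord1.
rewrite (expand_det_row _ ord0) /dotp; apply: eq_bigr => i _.
rewrite top; congr (_ * _); rewrite mxE (expand_det_row _ ord0) (bigD1 i) //=.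
rewrite big1 ?addr0 => [|j ji].
  rewrite top mxE !eqxx mul1r /cofactor; congr (_ * \det _).
  by apply/matrixP => a b; rewrite !mxE; case: splitP => // -[[]].
by rewrite top mxE (negbTE ji) andbF mul0r.
Qed.

Lemma cross_unique (R : realType) (n : nat) (U : 'M[R]_(n, n.+1))
    (w : 'rV[R]_n.+1) :
  (forall x, dotp x w = \det (col_mx x U : 'M[R]_n.+1)) -> w = cross U.
Proof.
move=> h; apply/rowP => i; rewrite [RHS]mxE -h /dotp (bigD1 i) //= big1 ?addr0.
  by rewrite !mxE !eqxx mul1r.
by move=> j ji; rewrite !mxE (negbTE ji) andbF mul0r.
Qed.

Lemma lebesgue_rV0 (R : realType) (d : nat) :
  lebesgue_rV (set0 : set 'rV[R]_d) = 0%E.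
Proof.
elim: d => [|d IH] /=; first by rewrite indic0.
by under eq_integral do rewrite IH; rewrite integral0.
Qed.

Lemma lebesgue_rV_box (R : realType) (d : nat) (a b : 'rV[R]_d) :
  (forall i, a 0 i <= b 0 i) ->
  lebesgue_rV [set x : 'rV[R]_d | forall i, a 0 i <= x 0 i <= b 0 i] =
  (\prod_i (b 0 i - a 0 i))%:E.
Proof.
elim: d a b => [a b ab|d IH a b ab] /=.
  by rewrite big_ord0 indicE mem_set // => -[].
pose a' : 'rV[R]_d := \row_i a 0 (lift ord0 i).
pose b' : 'rV[R]_d := \row_i b 0 (lift ord0 i).
have /IH {}IH : forall i, a' 0 i <= b' 0 i by move=> i; rewrite !mxE.
set c := \prod_i _ in IH.
transitivity (\int[lebesgue_measure]_(x in [set: R])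
    (c%:E * (\1_(`[a 0 ord0, b 0 ord0]%classic) x)%:E))%E.
  apply: eq_integral => x _.
  have row0 (y : 'rV[R]_d) : (row_mx (x%:M : 'rV[R]_1) y : 'rV[R]_d.+1) 0 ord0 = x.
    by rewrite mxE; case: splitP => // j _; rewrite ord1 mxE eqxx.
  have rowS (y : 'rV[R]_d) i :
      (row_mx (x%:M : 'rV[R]_1) y : 'rV[R]_d.+1) 0 (lift ord0 i) = y 0 i.
    rewrite mxE; case: splitP => [[[|//] ? //]|k [] /val_inj <- //].
  have E : [set y : 'rV[R]_d | forall i, a 0 i <=
        (row_mx (x%:M : 'rV[R]_1) y : 'rV[R]_d.+1) 0 i <= b 0 i] =
      [set y : 'rV[R]_d | a 0 ord0 <= x <= b 0 ord0 /\
        forall i, a' 0 i <= y 0 i <= b' 0 i].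
    apply/seteqP; split => y /= h.
      split; first by have := h ord0; rewrite row0.
      by move=> i; have := h (lift ord0 i); rewrite rowS !mxE.
    move=> i; case: (unliftP ord0 i) => [j|] ->; last by rewrite row0 h.1.
    by rewrite rowS; have := h.2 j; rewrite !mxE.
  rewrite E indicE mem_setE in_itv /=; case: (boolP (a 0 ord0 <= x <= b 0 ord0)) => xab.
    rewrite mule1 -IH; congr lebesgue_rV.
    by apply/seteqP; split => y /= => [[]|].
  rewrite mule0 (_ : mkset _ = set0); last first.
    by apply/seteqP; split => y /= => [[]|].
  exact: lebesgue_rV0.
rewrite ge0_integralZl_EFin //; first last.
- rewrite /c; apply: prodr_ge0 => i _; rewrite !mxE subr_ge0; exact: ab.
- exact/measurable_EFinP/measurable_indic.
rewrite integral_indic // setIT.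
have mE : lebesgue_measure `[a 0 ord0, b 0 ord0]%classic =
    (b 0 ord0 - a 0 ord0)%:E.
  rewrite lebesgue_measure_itv /= lte_fin; case: ltgtP (ab ord0) => // -> _.
  by rewrite subrr.
apply: (eq_trans (congr1 (fun z => c%:E * z)%E mE)).
rewrite big_ord_recl /= [in RHS]mulrC EFinM; congr (_ * _)%E.
by congr EFin; apply: eq_bigr => i _; rewrite !mxE.
Qed.

(* Main.v *)
From HB Require Import structures.
Require Import Defs.
From mathcomp Require Import all_boot all_order all_algebra.
From mathcomp Require Import all_classical all_reals all_analysis.
From mathcomp Require Import perm measurable_realfun lra ring.
Import Order.TTheory GRing.Theory Num.Theory numFieldNormedType.Exports.
Set Implicit Arguments.
Unset Strict Implicit.
Unset Printing Implicit Defensive.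
Local Open Scope classical_set_scope.
Local Open Scope ring_scope.

(* Write v0 = sum_j a_j e_j.  The origin being interior to the cone forces
   a_j < 0, and <e_i, tq_j> = delta_ij / a_j, so the whole polar description is
   read off coordinates in the basis e.  A d-simplex with edge matrix W has
   volume sqrt(det (W W^T)) / d!, by the linear change of variables for
   Lebesgue measure.  Let P have the rows -v0 and e_i (i in I), let N have the
   rows tq_j - tq_j0 and F the rows e_j (j in J, j <> j0, for a fixed j0 in J).
   The rows of P are orthogonal to those of N; multiplying the square matrix
   with blocks P, N by its own transpose and by that of the one with blocks P, F
   gives det(P;F)^2 det(N N^T) = det(P P^T) det(N F^T)^2.  Here N F^T is
   diagonal with entries 1 / a_j and det(P;F) = +- a_j0 det(e), which is the
   claimed ratio. *)

(** * Lebesgue measure on row vectors *)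

Definition rV_cylinders (R : realType) (d : nat) : set (set 'rV[R]_d) :=
  [set A | exists i (U : set (measurableTypeR R)),
    measurable U /\ A = (fun x : 'rV[R]_d => x 0 i) @^-1` U].

(* The Borel sets of R^d, presented by the coordinates so that a map into R^d is
   measurable as soon as its components are. *)
Definition rVm (R : realType) (d : nat) : measurableType _ :=
  g_sigma_algebraType (@rV_cylinders R d).

Lemma measurable_rV_coord (R : realType) (d : nat) (i : 'I_d) :
  measurable_fun setT (fun x : rVm R d => x 0 i : measurableTypeR R).
Proof. by move=> _ U mU; rewrite setTI; apply: sub_sigma_algebra; exists i, U. Qed.

Lemma measurable_fun_rV (R : realType) (d : nat) d' (T : measurableType d')
    (f : T -> rVm R d) :
  (forall i, measurable_fun setT (fun t => f t 0 i : measurableTypeR R)) ->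
  measurable_fun setT f.
Proof.
move=> mf; refine (@measurability _ _ T (rVm R d) setT f (@rV_cylinders R d) _ _) => //.
by move=> _ [_ [i [U [mU ->]]] <-]; exact: mf.
Qed.

Definition rV_cons (R : realType) (d : nat) (x : R) (y : 'rV[R]_d) : 'rV[R]_(1 + d) :=
  row_mx (x%:M : 'rV[R]_1) y.

Lemma rV_cons0 (R : realType) (d : nat) (x : R) (y : 'rV[R]_d) :
  rV_cons x y 0 ord0 = x.
Proof. by rewrite mxE; case: splitP => // j _; rewrite ord1 mxE eqxx. Qed.

Lemma rV_consS (R : realType) (d : nat) (x : R) (y : 'rV[R]_d) i :
  rV_cons x y 0 (lift ord0 i) = y 0 i.
Proof. by rewrite mxE; case: splitP => [[[|//] ? //]|k [] /val_inj <- //]. Qed.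

Lemma measurable_rV_cons (R : realType) (d : nat) :
  measurable_fun setT
    (fun z : measurableTypeR R * rVm R d => rV_cons z.1 z.2 : rVm R (1 + d)).
Proof.
apply: measurable_fun_rV => i; case: (unliftP ord0 i) => [j|] ->.
  under eq_fun do rewrite rV_consS.
  exact: (measurableT_comp (measurable_rV_coord j) measurable_snd).
under eq_fun do rewrite rV_cons0.
exact: measurable_fst.
Qed.

Lemma measurable_rV_affine (R : realType) (d d' : nat) (N : 'M[R]_(d, d'))
    (b : 'rV[R]_d') :
  measurable_fun setT (fun x : rVm R d => x *m N + b : rVm R d').
Proof.
apply: measurable_fun_rV => i; under eq_fun do rewrite !mxE.
apply: measurable_funD => //; apply: measurable_sum => j.
by apply: measurable_funM => //; exact: measurable_rV_coord.
Qed.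

Section prepend_lebesgue.
Context (R : realType) (d : nat) (mu : {sigma_finite_measure set (rVm R d) -> \bar R}).

(** The recursion step of [lebesgue_rV], packaged as a measure. Sigma-finiteness is carried along
    because the next product measure requires it. *)
Definition prepend_lebesgue : set (rVm R (1 + d)) -> \bar R :=
  pushforward (lebesgue_measure \x mu)%E
    (fun z : measurableTypeR R * rVm R d => rV_cons z.1 z.2 : rVm R (1 + d)).

Let nu : {measure set (rVm R (1 + d)) -> \bar R}.
Proof.
by unshelve refine (pushforward (lebesgue_measure \x mu)%E
  (fun z : measurableTypeR R * rVm R d => rV_cons z.1 z.2 : rVm R (1 + d)));
  exact: measurable_rV_cons.
Defined.

HB.instance Definition _ := isMeasure.Build _ _ _ prepend_lebesgue
  (measure0 nu) (measure_ge0 nu) (@measure_semi_sigma_additive _ _ _ nu).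

Let prepend_lebesgue_sigma_finite : sigma_finite setT prepend_lebesgue.
Proof.
have /sigma_finiteP[F [FT ndF Foo]] := sigma_finiteT (@lebesgue_measure R).
have /sigma_finiteP[G [GT ndG Goo]] := sigma_finiteT mu.
pose split (v : rVm R (1 + d)) : measurableTypeR R * rVm R d :=
  (v 0 ord0, rsubmx v).
have msplit : measurable_fun setT split.
  apply: measurable_fun_pair; first exact: measurable_rV_coord.
  apply: measurable_fun_rV => i; under eq_fun do rewrite mxE.
  exact: measurable_rV_coord.
(* Both exhaustions are increasing, so a point whose components lie in [F n] and [G k] lies in the
   box of index [maxn n k]. *)
exists (fun n => split @^-1` (F n `*` G n)).
  rewrite -preimage_bigcup -[LHS](preimage_setT split); congr (_ @^-1` _).
  rewrite -setXTT FT GT predeqE => -[x y]; split=> [[/= [n _ Fnx] [k _ Gky]]|].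
    exists (maxn n k) => //; split.
    - by move: x Fnx; exact/subsetPset/ndF/leq_maxl.
    - by move: y Gky; exact/subsetPset/ndG/leq_maxr.
  by move=> [n _ []/= ? ?]; split; exists n.
move=> n; have [mF Fn] := Foo n; have [mG Gn] := Goo n; split.
  by rewrite -[X in measurable X]setTI; apply: msplit => //; exact: measurableX.
rewrite /prepend_lebesgue /pushforward (_ : _ @^-1` _ = F n `*` G n).
  by rewrite product_measure1E// lte_mul_pinfty// ge0_fin_numE.
by apply/seteqP; split => -[x y] /=; rewrite /split rV_cons0 /rV_cons row_mxKr.
Qed.

HB.instance Definition _ := Measure_isSigmaFinite.Build _ _ _ prepend_lebesgue
  prepend_lebesgue_sigma_finite.

End prepend_lebesgue.

(** Iterated integrals hide countable additivity. Unfolding one coordinate at a time exhibits a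
    product measure, which makes sections measurable and Tonelli's theorem applicable. *)
Lemma lebesgue_rV_measure (R : realType) (d : nat) :
  exists mu : {sigma_finite_measure set (rVm R d) -> \bar R},
    forall A, mu A = lebesgue_rV A.
Proof.
elim: d => [|d [mu muE]].
  by exists (@dirac _ (rVm R 0) (0 : 'rV[R]_0) R : {finite_measure set _ -> \bar R}).
exists (prepend_lebesgue mu) => A.
rewrite /= /prepend_lebesgue /pushforward /product_measure1 /=.
apply: eq_integral => x _ /=; rewrite muE; congr lebesgue_rV.
by apply/seteqP; split => y; rewrite /xsection /= inE.
Qed.

Lemma measurable_lebesgue_rV_section (R : realType) (d : nat)
    (A : set (rVm R (1 + d))) :
  measurable A ->
  measurable_fun setT (fun x : measurableTypeR R =>
    lebesgue_rV [set y : 'rV[R]_d | A (rV_cons x y)]).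
Proof.
move=> mA; have [mu muE] := lebesgue_rV_measure R d.
have mA' : measurable [set z : measurableTypeR R * rVm R d | A (rV_cons z.1 z.2)].
  by rewrite -[X in measurable X]setTI; exact: measurable_rV_cons.
rewrite (_ : (fun x => _) = mu \o xsection
  [set z : measurableTypeR R * rVm R d | A (rV_cons z.1 z.2)]).
  exact: measurable_fun_xsection.
apply/funext => x /=; rewrite -muE; congr (mu _).
by apply/seteqP; split => y; rewrite /xsection /= inE.
Qed.

Lemma lebesgue_rV_ge0 (R : realType) (d : nat) (A : set 'rV[R]_d) :
  (0 <= lebesgue_rV A)%E.
Proof. by have [mu <-] := lebesgue_rV_measure R d; exact: measure_ge0. Qed.

(** * Affine change of variables *)

Lemma lebesgue_measure_affine (R : realType) (a b : R) (A : set (measurableTypeR R)) :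
  a != 0 -> measurable A ->
  lebesgue_measure A =
    (`|a|%:E * lebesgue_measure [set x : measurableTypeR R | A (x * a + b)%R])%E.
Proof.
move=> a0 mA.
pose g (x : measurableTypeR R) : measurableTypeR R := x * a + b.
have mg : measurable_fun setT g.
  by apply: measurable_funD => //; exact: measurable_funM.
have [nu nuE] : exists nu : {measure set (measurableTypeR R) -> \bar R}, forall A,
    nu A = lebesgue_measure (g @^-1` A).
  by unshelve eexists (pushforward lebesgue_measure _); [exact: g|exact: mg|].
have h0 : 0 <= `|a| by [].
(* Both sides are now measures of [A], so by uniqueness it suffices to compare them on half-open
   intervals. For negative [a] the preimage swaps the ends and becomes closed-open. *)
transitivity (mscale (NngNum h0) nu A); last by rewrite /mscale /= nuE.
apply: lebesgue_measure_unique => // _ [[x y] _ <-].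
rewrite /= /mscale /= nuE.
have [a_gt0|a_lt0|/eqP] := ltgtP 0 a; last by rewrite eq_sym (negbTE a0).
  have -> : g @^-1` `]x, y] = `](x - b) / a, (y - b) / a]%classic.
    apply/seteqP; split => z; rewrite /= !in_itv /= ltr_pdivrMr// ler_pdivlMr//;
      by rewrite ltrBlDr lerBrDr.
  rewrite !lebesgue_measure_itv /= !lte_fin ltr_pM2r ?invr_gt0// ltrD2r.
  case: ifPn => _; rewrite ?mule0// -!EFinB -EFinM gtr0_norm//; congr EFin.
  by field.
have -> : g @^-1` `]x, y] = `[(y - b) / a, (x - b) / a[%classic.
  apply/seteqP; split => z; rewrite /= !in_itv /= ltr_ndivlMr// ler_ndivrMr//;
    by rewrite ltrBlDr lerBrDr andbC.
rewrite !lebesgue_measure_itv /= !lte_fin ltr_nM2r ?invr_lt0// ltrD2r.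
case: ifPn => _; rewrite ?mule0// -!EFinB -EFinM ltr0_norm//; congr EFin.
by field.
Qed.

(** Lebesgue measure is [|a|] times its pushforward under [x * a + b], so the integral of [F] can be
    moved to the pushforward. *)
Lemma ge0_integral_affine (R : realType) (F : measurableTypeR R -> \bar R) (a b : R) :
  a != 0 -> measurable_fun setT F -> (forall x, 0 <= F x)%E ->
  (\int[lebesgue_measure]_x F (x * a + b)%R =
   (`|a|^-1)%:E * \int[lebesgue_measure]_x F x)%E.
Proof.
move=> a0 mF F0.
pose g (x : measurableTypeR R) : measurableTypeR R := x * a + b.
have mg : measurable_fun setT g.
  by apply: measurable_funD => //; exact: measurable_funM.
have [nu nuE] : exists nu : {measure set (measurableTypeR R) -> \bar R},
    (nu : set _ -> \bar R) = pushforward lebesgue_measure g.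
  by unshelve eexists (pushforward lebesgue_measure _); [exact: g|exact: mg|].
have h0 : 0 <= `|a| by [].
have -> : (\int[lebesgue_measure]_x F x = `|a|%:E * \int[nu]_x F x)%E.
  rewrite -(ge0_integral_mscale _ _ (NngNum h0))//.
  apply: eq_measure_integral => A mA _.
  by rewrite /= /mscale /= nuE; exact: lebesgue_measure_affine.
rewrite nuE ge0_integral_pushforward// muleA -EFinM mulVf ?normr_eq0// mul1e.
by rewrite preimage_setT.
Qed.

(** The property is multiplicative in [N], so it can be checked on factors. The translation [b] is
    built in because sections of block triangular maps are translated by an amount depending on the
    first coordinate. *)
Definition scales_lebesgue (R : realType) (d : nat) (N : 'M[R]_d) : Prop :=
  forall (b : 'rV[R]_d) (A : set (rVm R d)), measurable A ->
    lebesgue_rV [set x | A (x *m N + b)] = ((`|\det N|^-1)%:E * lebesgue_rV A)%E.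

Lemma measurable_affine_preimage (R : realType) (d d' : nat) (N : 'M[R]_(d, d'))
    (b : 'rV[R]_d') (A : set (rVm R d')) : measurable A ->
  measurable ([set x | A (x *m N + b)] : set (rVm R d)).
Proof. by move=> mA; rewrite -[X in measurable X]setTI; exact: measurable_rV_affine. Qed.

Lemma scales_lebesgueM (R : realType) (d : nat) (M N : 'M[R]_d) :
  scales_lebesgue M -> scales_lebesgue N -> scales_lebesgue (M *m N).
Proof.
move=> hM hN b A mA.
rewrite (_ : mkset _ = [set x | [set y | A (y *m N + b)] (x *m M + 0)]).
  rewrite hM; last exact: measurable_affine_preimage.
  by rewrite hN// det_mulmx normrM invfM EFinM muleA.
by apply/seteqP; split => x /=; rewrite addr0 mulmxA.
Qed.

Lemma measurable_rV_section (R : realType) (d : nat) (A : set (rVm R (1 + d)))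
    (x : R) :
  measurable A -> measurable ([set y | A (rV_cons x y)] : set (rVm R d)).
Proof.
move=> mA; rewrite -[X in measurable X]setTI.
have m1 : measurable_fun setT (fun y : rVm R d => (x : measurableTypeR R, y)).
  exact: measurable_fun_pair.
exact: (measurableT_comp (@measurable_rV_cons R d) m1).
Qed.

(** The first coordinate of the image depends only on the first coordinate [x]. The section of the
    preimage at [x] is thus an affine preimage, with linear part [B], of the section of [A] at the
    image coordinate; a one-dimensional substitution finishes. *)
Lemma scales_lebesgue_block (R : realType) (d : nat) (a : 'M[R]_1)
    (c : 'M[R]_(1, d)) (B : 'M[R]_d) :
  block_mx a c 0 B \in unitmx -> (B \in unitmx -> scales_lebesgue B) ->
  scales_lebesgue (block_mx a c 0 B : 'M[R]_(1 + d)).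
Proof.
rewrite unitmxE det_ublock unitrM -!unitmxE => /andP[ua uB] /(_ uB) hB b A mA.
have a0 : a 0 0 != 0 by move: ua; rewrite unitmxE det_mx11 unitfE.
rewrite det_ublock det_mx11 normrM invfM.
pose F (x : measurableTypeR R) := lebesgue_rV [set y | A (rV_cons x y)].
have F0 x : (0 <= F x)%E by exact: lebesgue_rV_ge0.
have mF : measurable_fun setT F by exact: measurable_lebesgue_rV_section.
transitivity (\int[lebesgue_measure]_x
    ((`|\det B|^-1)%:E * F (x * a 0 0 + b 0 ord0)%R))%E.
  rewrite /=; apply: eq_integral => x _.
  rewrite -(hB (x *: c + rsubmx b)); last exact: measurable_rV_section.
  congr lebesgue_rV; apply/seteqP.
  suff E y : (row_mx x%:M y : 'rV[R]_(1 + d)) *m block_mx a c 0 B + b =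
      rV_cons (x * a 0 0 + b 0 ord0) (y *m B + (x *: c + rsubmx b)).
    by split => y /=; rewrite E.
  rewrite mul_row_block mulmx0 addr0 !mul_scalar_mx -[b in LHS]hsubmxK add_row_mx.
  congr row_mx; last by rewrite addrCA addrA.
  apply/matrixP => i j; rewrite !ord1 !mxE eqxx mulr1n; congr (_ + b _ _).
  exact/val_inj.
have mFg : measurable_fun setT (fun x : measurableTypeR R => F (x * a 0 0 + b 0 ord0)%R).
  apply: measurableT_comp => //.
  by apply: measurable_funD => //; exact: measurable_funM.
rewrite ge0_integralZl_EFin//.
by rewrite ge0_integral_affine// muleA -EFinM mulrC.
Qed.

Lemma scales_lebesgue_dim0 (R : realType) (N : 'M[R]_0) : scales_lebesgue N.
Proof.
by move=> b A _; rewrite det_mx00 normr1 invr1 mul1e; congr lebesgue_rV;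
  apply/seteqP; split => x /=; rewrite [_ + b]thinmx0 [x]thinmx0.
Qed.

Lemma scales_lebesgue1 (R : realType) (d : nat) : scales_lebesgue (1%:M : 'M[R]_d).
Proof.
elim: d => [|d IH]; first exact: scales_lebesgue_dim0.
rewrite (@scalar_mx_block _ 1 d); apply: scales_lebesgue_block => //.
by rewrite -scalar_mx_block unitmx1.
Qed.

(** Swapping the first two coordinates exchanges the two outer integrals, so this is Tonelli's
    theorem; the determinant is [-1]. *)
Lemma scales_lebesgue_swap (R : realType) (d : nat) :
  scales_lebesgue (tperm_mx ord0 (lift ord0 ord0) : 'M[R]_(1 + (1 + d))).
Proof.
set s : 'M[R]_(1 + (1 + d)) := tperm_mx _ _.
suff swap (A : set (rVm R (1 + (1 + d)))) : measurable A ->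
    lebesgue_rV [set x | A (x *m s)] = lebesgue_rV A.
  move=> b A mA.
  rewrite (_ : [set x | A (x *m s + b)] = [set x | [set y | A (y *m 1%:M + b)] (x *m s)]).
    rewrite swap; last exact: measurable_affine_preimage.
    by rewrite scales_lebesgue1// det1 /s /tperm_mx det_perm odd_tperm /= expr1 normrN.
  by apply/seteqP; split => x /=; rewrite mulmx1.
move=> mA.
have sE x y (z : 'rV[R]_d) : rV_cons x (rV_cons y z) *m s = rV_cons y (rV_cons x z).
  rewrite -xcolE; apply/rowP => i; rewrite mxE.
  case: (unliftP ord0 i) => [j|] ->; last by rewrite tpermL rV_cons0 rV_consS rV_cons0.
  case: (unliftP ord0 j) => [k|] ->.
    by rewrite tpermD ?rV_consS// -(inj_eq val_inj).
  by rewrite tpermR rV_consS !rV_cons0.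
pose F (p : measurableTypeR R * measurableTypeR R) :=
  lebesgue_rV [set z | A (rV_cons p.1 (rV_cons p.2 z))].
have mF : measurable_fun setT F.
  have [mu muE] := lebesgue_rV_measure R d.
  pose g (q : (measurableTypeR R * measurableTypeR R) * rVm R d) :
    rVm R (1 + (1 + d)) := rV_cons q.1.1 (rV_cons q.1.2 q.2).
  have mg : measurable_fun setT g.
    have m1 : measurable_fun setT
        (fun q : (measurableTypeR R * measurableTypeR R) * rVm R d => q.1.1).
      exact: (measurableT_comp measurable_fst measurable_fst).
    have m2 : measurable_fun setT
        (fun q : (measurableTypeR R * measurableTypeR R) * rVm R d =>
          rV_cons q.1.2 q.2 : rVm R (1 + d)).
      have m3 : measurable_fun setT
          (fun q : (measurableTypeR R * measurableTypeR R) * rVm R d => (q.1.2, q.2)).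
        apply: measurable_fun_pair => //.
        exact: (measurableT_comp measurable_snd measurable_fst).
      exact: (measurableT_comp (@measurable_rV_cons R d) m3).
    exact: (measurableT_comp (@measurable_rV_cons R (1 + d)) (measurable_fun_pair m1 m2)).
  have mA' : measurable (g @^-1` A) by rewrite -[X in measurable X]setTI; exact: mg.
  rewrite (_ : F = mu \o xsection (g @^-1` A)); first exact: measurable_fun_xsection.
  apply/funext => -[x y]; rewrite /F /= -muE; congr (mu _).
  by apply/seteqP; split => z; rewrite /xsection /= inE.
transitivity (\int[lebesgue_measure]_x \int[lebesgue_measure]_y F (y, x))%E.
  rewrite /=; apply: eq_integral => x _; apply: eq_integral => y _.
  by rewrite /F; congr lebesgue_rV; apply/seteqP; split => z /=;
    rewrite -[row_mx x%:M _]/(rV_cons x (rV_cons y z)) sE.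
by rewrite -fubini_tonelli// => p; exact: lebesgue_rV_ge0.
Qed.

(* The two double cosets of the stabilizer of a line in GL_d: an invertible M
   that is not block triangular is a product N * swap * N0 with N and N0 block
   triangular. *)
Lemma block_swap_factor (R : realType) (d : nat) (M : 'M[R]_(1 + (1 + d))) :
  dlsubmx M != 0 ->
  exists N N' : 'M[R]_(1 + (1 + d)),
    [/\ N *m N' = 1%:M, dlsubmx N = 0 &
      @dlsubmx R 1 (1 + d) 1 (1 + d)
        (tperm_mx ord0 (lift ord0 ord0) *m (N' *m M)) = 0].
Proof.
set c := dlsubmx M => c0.
have [i ci] : exists i, c i 0 != 0 by move/cV0Pn: c0.
(* Since [c] is a single column, [G *m c] vanishes below its top entry. *)
pose G := invmx (col_ebase c).
have uE : col_ebase c \in unitmx by exact: col_ebase_unit.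
(* Chosen so that adding [t *m c] cancels the top-left entry of [M]. The first column of [N' *m M]
   is then zero except in its second entry, which the swap brings to the top. *)
pose t : 'rV[R]_(1 + d) := (- ulsubmx M 0 0 / c i 0) *: delta_mx 0 i.
pose N' : 'M[R]_(1 + (1 + d)) := block_mx 1%:M t 0 G.
exists (block_mx 1%:M (- (t *m col_ebase c)) 0 (col_ebase c)), N'; split.
- rewrite /N' mulmx_block !mul1mx !mulmx0 !mul0mx !addr0 add0r mulNmx mulmxK//.
  by rewrite subrr mulmxV// -scalar_mx_block.
- by rewrite block_mxKdl.
have NM : lsubmx (N' *m M) = col_mx 0 (G *m c).
  rewrite -[M in LHS]submxK mulmx_block block_mxEh row_mxKl mul0mx add0r -/c mul1mx.
  congr col_mx; apply/matrixP => a b; rewrite !ord1 !mxE (bigD1 i)//= big1 => [|j ji].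
    by move: ci; rewrite !mxE !eqxx /= mulr1 addr0 => ci; rewrite divfK// subrr.
  by rewrite !mxE (negbTE ji) andbF mulr0 mul0r.
have Gc : G *m c = pid_mx (\rank c) *m row_ebase c.
  by rewrite -{1}[c]mulmx_ebase !mulmxA mulVmx// mul1mx.
have NME a : (N' *m M) a (lshift _ ord0) = (col_mx 0 (G *m c) : 'cV_(1 + (1 + d))) a ord0.
  by rewrite -NM [RHS]mxE.
have dlE (X : 'M[R]_(1 + (1 + d))) a b :
    dlsubmx X a b = X (rshift 1 a) (lshift (1 + d) b) by rewrite !mxE.
apply/matrixP => a b; rewrite dlE -xrowE ord1 [RHS]mxE [LHS]mxE.
case: (unliftP ord0 a) => [j|] ->.
  have -> : rshift 1 (lift ord0 j) = lift ord0 (lift ord0 j) :> 'I_(1 + (1 + d)).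
    exact/val_inj.
  rewrite tpermD// NME (_ : lift ord0 _ = rshift 1 (lift ord0 j)); last exact/val_inj.
  rewrite col_mxEd Gc mxE big_ord1 [X in X * _]mxE mul0r//.
have -> : rshift 1 (ord0 : 'I_(1 + d)) = lift ord0 ord0 :> 'I_(1 + (1 + d)).
  exact/val_inj.
rewrite tpermR NME.
transitivity ((col_mx 0 (G *m c) : 'cV_(1 + (1 + d))) (lshift _ ord0) ord0).
  by congr (col_mx _ _ _ _); exact/val_inj.
by rewrite col_mxEu mxE.
Qed.

Lemma scales_lebesgue_unit (R : realType) (d : nat) (N : 'M[R]_d) :
  N \in unitmx -> scales_lebesgue N.
Proof.
elim: d N => [|d IH] N uN; first exact: scales_lebesgue_dim0.
have block (M : 'M[R]_(1 + d)) : dlsubmx M = 0 -> M \in unitmx -> scales_lebesgue M.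
  move=> M0; rewrite -[M]submxK M0 => uM.
  by apply: scales_lebesgue_block => // uB; exact: IH.
have [N0|N0] := eqVneq (@dlsubmx _ 1 d 1 d N) 0; first exact: block.
(* In dimension one the lower-left block is empty, contradicting [N0]; otherwise there are two
   coordinates to swap. *)
case: d => [|d] in N uN IH block N0 *.
  by move: N0; rewrite [dlsubmx _]flatmx0 eqxx.
have [P [P' [PP P0 WPN0]]] := block_swap_factor N0.
have [uP uP'] := mulmx1_unit PP.
have WW : tperm_mx ord0 (lift ord0 ord0) *m tperm_mx ord0 (lift ord0 ord0) =
    1%:M :> 'M[R]_(1 + (1 + d)).
  by rewrite -perm_mxM tperm2 perm_mx1.
have [uW _] := mulmx1_unit WW.
(* The swap is an involution. Both [P] and the innermost bracketed product, which starts with a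
   swap, are block triangular. *)
have -> : N = P *m (tperm_mx ord0 (lift ord0 ord0) *m
    (tperm_mx ord0 (lift ord0 ord0) *m (P' *m N))).
  by rewrite [X in P *m X]mulmxA WW mul1mx mulmxA PP mul1mx.
apply: scales_lebesgueM; first exact: block.
apply: scales_lebesgueM; first exact: scales_lebesgue_swap.
by apply: block => //; rewrite !unitmx_mul uW uP'.
Qed.

(** * Volume of the corner simplex *)

Lemma measurable_indic_power (R : realType) (r : R) (n : nat) :
  measurable_fun setT
    (fun x : measurableTypeR R => (\1_(`[0, r]%classic) x * (r - x) ^+ n)%:E).
Proof.
apply/measurable_EFinP; apply: measurable_funM; first exact: measurable_indic.
by apply: measurable_funX; exact: measurable_funB.
Qed.

Lemma indic_power_ge0 (R : realType) (r : R) (n : nat) (x : R) :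
  0 <= \1_(`[0, r]%classic) x * (r - x) ^+ n.
Proof.
rewrite indicE; have [|_] := boolP (_ \in _); last by rewrite mul0r.
by rewrite inE /= in_itv /= => /andP[_ xr]; rewrite mul1r exprn_ge0// subr_ge0.
Qed.

Lemma integral_power01 (R : realType) (n : nat) :
  (\int[lebesgue_measure]_x (\1_(`[0%R, 1%R]%classic) x * (1 - x) ^+ n)%:E =
   (n.+1%:R^-1 : R)%:E)%E.
Proof.
rewrite -Rintegral_onemXn /Rintegral fineK.
  rewrite [RHS]integral_mkcond; apply: eq_integral => x _.
  rewrite patchE indicE; case: ifPn; rewrite ?mul1r ?mul0r//.
apply: integrable_fin_num => //.
have := @integrable_XMonemX R 0 n.
by apply: eq_integrable => // x _ /=; rewrite XMonemX0n.
Qed.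

(** Substituting [x * r] reduces to the unit interval. For [r = 0] no rescaling is possible, but the
    integrand is supported on a single point. *)
Lemma integral_power (R : realType) (r : R) (n : nat) : 0 <= r ->
  (\int[lebesgue_measure]_x (\1_(`[0%R, r]%classic) x * (r - x) ^+ n)%:E =
   (r ^+ n.+1 / n.+1%:R)%:E)%E.
Proof.
rewrite le_eqVlt => /predU1P[<-|r0].
  rewrite expr0n mul0r set_itv1.
  transitivity (\int[lebesgue_measure]_x ((0 ^+ n)%:E * (\1_[set 0%R] x)%:E : \bar R))%E.
    apply: eq_integral => x _; rewrite -EFinM mulrC indicE.
    by have [|] := boolP (_ \in _); rewrite ?mulr0// inE /= => ->; rewrite subr0.
  rewrite ge0_integralZl_EFin ?exprn_ge0//; last first.
    exact/measurable_EFinP/measurable_indic.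
  rewrite integral_indic// setIT; have l0 := lebesgue_measure_set1 (0 : R).
  by apply: (eq_trans (congr1 (fun z => _ * z)%E l0)); rewrite mule0.
pose F (x : measurableTypeR R) : \bar R := (\1_(`[0, r]%classic) x * (r - x) ^+ n)%:E.
have F0 x : (0 <= F x)%E by rewrite lee_fin indic_power_ge0.
have mF : measurable_fun setT F by exact: measurable_indic_power.
have -> : (\int[lebesgue_measure]_x F x =
    r%:E * \int[lebesgue_measure]_x F (x * r + 0)%R)%E.
  rewrite ge0_integral_affine ?gt_eqF// muleA -EFinM gtr0_norm//.
  by rewrite mulfV ?gt_eqF// mul1e.
transitivity (r%:E * \int[lebesgue_measure]_x
    ((r ^+ n)%:E * (\1_(`[0%R, 1%R]%classic) x * (1 - x) ^+ n)%:E))%E.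
  congr (_ * _)%E; apply: eq_integral => x _; rewrite /F addr0 -EFinM; congr EFin.
  rewrite !indicE !mem_setE !in_itv /= pmulr_lge0// -ler_pdivlMr// divff ?gt_eqF//.
  by rewrite mulrCA -exprMn mulrBr mulr1 [r * x]mulrC.
rewrite ge0_integralZl_EFin ?exprn_ge0 ?ltW//; last 2 first.
  by move=> x _; rewrite lee_fin indic_power_ge0.
  exact: measurable_indic_power.
by rewrite integral_power01 -!EFinM mulrA -exprS.
Qed.

(** The size [r] is a parameter for the sake of induction on [d]: the section at a first coordinate
    [x] between [0] and [r] is the corner simplex of size [r - x]. *)
Definition corner_simplex (R : realType) (d : nat) (r : R) : set 'rV[R]_d :=
  [set c | (forall i, 0 <= c 0 i) /\ \sum_i c 0 i <= r].

Lemma measurable_corner_simplex (R : realType) (d : nat) (r : R) :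
  measurable (@corner_simplex R d r : set (rVm R d)).
Proof.
rewrite (_ : corner_simplex r = \bigcap_(i in [set: 'I_d]) [set c : rVm R d | 0 <= c 0 i]
    `&` [set c : rVm R d | \sum_i c 0 i <= r]).
  apply: measurableI.
    apply: fin_bigcap_measurable => // i _.
    rewrite -[X in measurable X]setTI; apply: measurable_fun_le => //.
    exact: measurable_rV_coord.
  rewrite -[X in measurable X]setTI; apply: measurable_fun_le => //.
  by apply: measurable_sum => i; exact: measurable_rV_coord.
apply/seteqP; split => c /= [h1 h2]; first by split => // i _; exact: h1.
by split => // i; exact: (h1 i I).
Qed.

Lemma lebesgue_corner_simplex (R : realType) (d : nat) (r : R) : 0 <= r ->
  lebesgue_rV (@corner_simplex R d r) = (r ^+ d / d`!%:R)%:E.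
Proof.
elim: d r => [|d IH] r r0.
  rewrite /= expr0 fact0 divr1 indicE mem_set//; split; first by case.
  by rewrite big_ord0.
transitivity (\int[lebesgue_measure]_x
    ((d`!%:R^-1)%:E * (\1_(`[0, r]%classic) x * (r - x) ^+ d)%:E))%E.
  rewrite /=; apply: eq_integral => x _.
  rewrite (_ : [set y | _] = [set y | 0 <= x <= r /\ corner_simplex (r - x) y]).
    rewrite indicE mem_setE in_itv /=; case: (boolP (0 <= x <= r)) => [/andP[x0 xr]|xr].
      rewrite mul1r -EFinM mulrC -IH ?subr_ge0//; congr lebesgue_rV.
      by apply/seteqP; split => y /= => [[]|].
    rewrite mul0r mule0 -[RHS](@lebesgue_rV0 R d); congr lebesgue_rV.
    by apply/seteqP; split => y /= => [[]|].
  apply/seteqP; split => y /=; rewrite -[row_mx _ _]/(rV_cons x y).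
    move=> [h]; rewrite big_ord_recl rV_cons0.
    under eq_bigr do rewrite rV_consS.
    move=> s; have y0 i : 0 <= y 0 i by rewrite -(rV_consS x).
    have x0 : 0 <= x by rewrite -(rV_cons0 x y).
    have s0 : 0 <= \sum_i y 0 i by apply: sumr_ge0.
    split; first by rewrite x0 /=; lra.
    by split => //; lra.
  move=> [/andP[x0 xr] [y0 s]]; split.
    by move=> i; case: (unliftP ord0 i) => [j|] ->; rewrite ?rV_consS ?rV_cons0.
  rewrite big_ord_recl rV_cons0; under eq_bigr do rewrite rV_consS.
  lra.
rewrite ge0_integralZl_EFin//; last 2 first.
  by move=> x _; rewrite lee_fin indic_power_ge0.
  exact: measurable_indic_power.
rewrite integral_power// -EFinM; congr EFin.
by rewrite factS natrM invfM mulrCA [X in _ * X = _]mulrC.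
Qed.

(** * Gram determinants and volumes of simplices *)

Lemma mulmx_tr_dotp (R : realType) (k : nat) (u v : 'rV[R]_k) :
  (u *m v^T) 0 0 = dotp u v.
Proof. by rewrite mxE; apply: eq_bigr => i _; rewrite mxE. Qed.

Lemma dotpC (R : realType) (k : nat) (u v : 'rV[R]_k) : dotp u v = dotp v u.
Proof. by apply: eq_bigr => i _; rewrite mulrC. Qed.

Lemma dotpDr (R : realType) (k : nat) (u v w : 'rV[R]_k) :
  dotp u (v + w) = dotp u v + dotp u w.
Proof. by rewrite /dotp -big_split; apply: eq_bigr => i _; rewrite mxE mulrDr. Qed.

Lemma dotpZr (R : realType) (k : nat) (t : R) (u v : 'rV[R]_k) :
  dotp u (t *: v) = t * dotp u v.
Proof. by rewrite /dotp mulr_sumr; apply: eq_bigr => i _; rewrite mxE mulrCA. Qed.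

Lemma dotp_sumr (R : realType) (k r : nat) (u : 'rV[R]_k) (t : 'I_r -> R)
    (v : 'I_r -> 'rV[R]_k) :
  dotp u (\sum_i t i *: v i) = \sum_i t i * dotp u (v i).
Proof.
rewrite -mulmx_tr_dotp linear_sum mulmx_sumr summxE; apply: eq_bigr => i _.
by rewrite mulmx_tr_dotp dotpZr.
Qed.

Lemma dotpBr (R : realType) (k : nat) (u v w : 'rV[R]_k) :
  dotp u (v - w) = dotp u v - dotp u w.
Proof. by rewrite dotpDr -scaleN1r dotpZr mulN1r. Qed.

(** Gram-Schmidt, with the first row orthogonalized against an orthonormal system already built from
    the other rows. *)
Lemma orthonormal_factor (R : realType) (d k : nat) (W : 'M[R]_(d, k)) :
  row_free W ->
  exists (B : 'M[R]_(d, k)) (Y : 'M[R]_d), B *m B^T = 1%:M /\ W = Y *m B.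
Proof.
elim: d W => [|d IH] W fW.
  by exists 0, 0; split; apply/matrixP => -[].
pose u : 'rV[R]_k := usubmx (W : 'M[R]_(1 + d, k)).
pose W' : 'M[R]_(d, k) := dsubmx (W : 'M[R]_(1 + d, k)).
have WE : W = col_mx u W' :> 'M[R]_(1 + d, k) by rewrite vsubmxK.
have fW' : row_free W'.
  apply: inj_row_free => x xW'.
  have : (row_mx 0 x : 'rV[R]_(1 + d)) *m (W : 'M[R]_(1 + d, k)) = 0.
    by rewrite WE mul_row_col mul0mx add0r.
  move/eqP; rewrite (mulmx_free_eq0 _ fW) => /eqP.
  by move/(congr1 (@rsubmx R 1 1 d)); rewrite row_mxKr linear0.
have [B [Y [BB W'E]]] := IH _ fW'.
pose w := u - u *m B^T *m B.
have wB : w *m B^T = 0 by rewrite mulmxBl -!mulmxA BB mulmx1 subrr.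
have w0 : w != 0.
  (* If [w] vanished, all [d.+1] independent rows of [W] would lie in the span of the [d] rows of
     [B]. *)
  apply/eqP => /subr0_eq uE.
  have WB : (W <= B)%MS.
    have E : (col_mx (u *m B^T) Y : 'M[R]_(1 + d, d)) *m B = col_mx u W'.
      by rewrite mul_col_mx -uE -W'E.
    by rewrite WE; apply/submxP; exists (col_mx (u *m B^T) Y); exact/esym.
  have := mxrankS WB; rewrite (eqP (fW : \rank W == d.+1)).
  by move=> /leq_trans /(_ (rank_leq_row _)); rewrite ltnn.
have ww : 0 < dotp w w.
  have [i wi] : exists i, w 0 i != 0 by apply/rV0Pn.
  rewrite /dotp (bigD1 i)//= ltr_pwDl//.
    by rewrite -expr2 lt_def sqrf_eq0 wi sqr_ge0.
  by apply: sumr_ge0 => j _; rewrite -expr2 sqr_ge0.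
pose s := Num.sqrt (dotp w w).
have s0 : s != 0 by rewrite sqrtr_eq0 -ltNge.
pose B' : 'M[R]_(1 + d, k) := col_mx (s^-1 *: w) B.
pose Y' : 'M[R]_(1 + d) := block_mx s%:M (u *m B^T) 0 Y.
have BB' : B' *m B'^T = 1%:M.
  rewrite tr_col_mx mul_col_row BB linearZ /= -!scalemxAr -!scalemxAl wB !scaler0.
  have -> : B *m w^T = 0 by apply: trmx_inj; rewrite trmx_mul trmxK wB trmx0.
  rewrite scaler0 (@scalar_mx_block _ 1 d); congr block_mx.
  apply/matrixP => i j; rewrite !ord1 mxE mxE mulmx_tr_dotp mxE eqxx mulr1n.
  by rewrite mulrA -invfM -expr2 sqr_sqrtr ?ltW// mulVf ?gt_eqF.
have YB' : Y' *m B' = col_mx u W'.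
  rewrite mul_block_col mul0mx add0r -W'E; congr col_mx.
  by rewrite mul_scalar_mx scalerA mulfV// scale1r subrK.
by exists B', Y'; split=> //; rewrite YB'.
Qed.

(** [vol] is an infimum over charts; when some chart exists and all charts agree, it is the infimum
    of a singleton. *)
Lemma vol_chart (R : realType) (k d : nat) (S : set 'rV[R]_k) (a : \bar R) :
  (exists (p : 'rV[R]_k) (B : 'M[R]_(d, k)), B *m B^T = 1%:M /\
      S `<=` range (fun x : 'rV[R]_d => p + x *m B)) ->
  (forall (p : 'rV[R]_k) (B : 'M[R]_(d, k)), B *m B^T = 1%:M ->
    S `<=` range (fun x : 'rV[R]_d => p + x *m B) ->
    lebesgue_rV [set x : 'rV[R]_d | S (p + x *m B)] = a) ->
  vol d S = a.
Proof.
move=> [p [B [BB SB]]] h; rewrite /vol.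
rewrite (_ : mkset _ = [set a]) ?ereal_inf1//; apply/seteqP; split => x /=.
  by move=> [p' [B' [BB' SB' ->]]]; exact: h.
by move=> ->; exists p, B; split => //; rewrite h.
Qed.

(** In any chart [W = Y *m B] with [Y] invertible, so the simplex pulls back to an affine image of
    the corner simplex with linear part [Y]. Its measure is [|det Y| / d!], and the Gram determinant
    is [det Y ^+ 2]. *)
Lemma vol_simplex (R : realType) (k d : nat) (v : 'rV[R]_k) (W : 'M[R]_(d, k)) :
  row_free W ->
  vol d [set v + c *m W | c in @corner_simplex R d 1] =
    (Num.sqrt (\det (W *m W^T)) / d`!%:R)%:E.
Proof.
move=> fW; apply: vol_chart => [|p B BB SB].
  have [B [Y [BB WE]]] := orthonormal_factor fW.
  exists v, B; split => // _ [c _ <-]; exists (c *m Y) => //.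
  by rewrite WE mulmxA.
have vS : [set v + c *m W | c in corner_simplex 1] v.
  exists 0; last by rewrite mul0mx addr0.
  by split => [i|]; rewrite ?big1// => *; rewrite mxE.
have [y0 _ y0E] := SB _ vS.
pose Y := W *m B^T.
(* Each edge is a difference of two vertices lying in the chart, hence lies in the row space of
   [B]. *)
have WE : W = Y *m B.
  apply/row_matrixP => i; rewrite row_mul.
  have /SB[y _ yE] : [set v + c *m W | c in corner_simplex 1] (v + row i W).
    exists (delta_mx 0 i); last by rewrite -rowE.
    split => [j|]; first by rewrite mxE ler0n.
    rewrite (bigD1 i)//= big1 => [|j ji]; first by rewrite mxE !eqxx addr0.
    by rewrite mxE (negbTE ji) andbF.
  have rE : row i W = (y - y0) *m B.
    by rewrite mulmxBl -[LHS](addKr v) -yE -y0E opprD addrACA addNr add0r addrC.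
  by rewrite /Y row_mul rE -!mulmxA (mulmxA B) BB mul1mx.
have uY : Y \in unitmx.
  rewrite -row_free_unit /row_free eqn_leq rank_leq_row /=.
  by rewrite -{1}(eqP fW) WE mxrankM_maxl.
have -> : \det (W *m W^T) = \det Y ^+ 2.
  by rewrite WE trmx_mul mulmxA -(mulmxA Y) BB mulmx1 det_mulmx det_tr.
rewrite sqrtr_sqr.
rewrite (_ : mkset _ = [set x | corner_simplex 1 (x *m invmx Y + - (y0 *m invmx Y))]).
  rewrite (scales_lebesgue_unit _); last 2 first.
  - by rewrite unitmx_inv.
  - exact: measurable_corner_simplex.
  by rewrite det_inv normfV invrK lebesgue_corner_simplex// expr1n -EFinM mul1r.
have chartE c x : (v + c *m W = p + x *m B) <-> c = x *m invmx Y - y0 *m invmx Y.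
  rewrite -y0E WE mulmxA -addrA -mulmxDl; split=> [/addrI/(congr1 (mulmx^~ B^T))|->].
    by rewrite -!mulmxA BB !mulmx1 => <-; rewrite mulmxDl mulmxK// addrAC subrr add0r.
  by rewrite mulmxBl !mulmxKV// subrKC.
apply/seteqP; split => x /=; first by move=> [c cS /chartE <-].
by move=> cS; exists (x *m invmx Y - y0 *m invmx Y) => //; exact/chartE.
Qed.

(** The coefficients with respect to [e] carry the parallelepiped to the unit cube. A chart of full
    dimension has a square orthogonal [B], of determinant [1] or [-1], so it does not affect the
    value. *)
Lemma vol_parallelepiped (R : realType) (k : nat) (e : 'I_k -> 'rV[R]_k) :
  row_free (\matrix_i e i) ->
  vol k (parallelepiped e) = `|\det (\matrix_i e i)|%:E.
Proof.
rewrite row_free_unit; set M := \matrix_i e i => uM.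
have parE x : parallelepiped e x <-> forall i, 0 <= (x *m invmx M) 0 i <= 1.
  split=> [[t [t01 ->]] i|x01].
    have -> : \sum_i t i *: e i = (\row_i t i) *m M.
      by rewrite mulmx_sum_row; apply: eq_bigr => j _; rewrite rowK mxE.
    by rewrite mulmxK// mxE.
  exists ((x *m invmx M) 0); split => //; rewrite -[LHS](mulmxKV uM) mulmx_sum_row.
  by apply: eq_bigr => j _; rewrite rowK.
pose cube : set (rVm R k) := [set x | forall i, 0 <= x 0 i <= 1].
have mcube : measurable cube.
  rewrite (_ : cube = \bigcap_(i in [set: 'I_k])
      ((fun x : rVm R k => x 0 i : measurableTypeR R) @^-1` `[0, 1])).
    apply: fin_bigcap_measurable => // i _.
    by rewrite -[X in measurable X]setTI; exact: measurable_rV_coord.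
  apply/seteqP; split => x /= h i; first by rewrite /= in_itv /= h.
  by have := h i I; rewrite /= in_itv.
have cube1 : lebesgue_rV cube = 1%E.
  rewrite (_ : cube = [set x : 'rV[R]_k |
      forall i, (0 : 'rV[R]_k) 0 i <= x 0 i <= (\row__ 1 : 'rV[R]_k) 0 i]).
    rewrite lebesgue_rV_box => [|i]; last by rewrite !mxE.
    by rewrite big1// => i _; rewrite !mxE subr0.
  by apply/seteqP; split => x /= h i; have := h i; rewrite !mxE.
apply: vol_chart => [|p B BB _].
  exists 0, 1%:M; rewrite trmx1 mulmx1; split => // x _.
  by exists x => //; rewrite mulmx1 add0r.
have [uB _] := mulmx1_unit BB.
rewrite (_ : mkset _ = [set x | cube (x *m (B *m invmx M) + p *m invmx M)]).
  rewrite (scales_lebesgue_unit _)//; last by rewrite unitmx_mul uB unitmx_inv.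
  rewrite cube1 mule1 det_mulmx det_inv normrM normfV invfM invrK.
  have : \det B ^+ 2 = 1 by rewrite -[RHS](det1 R k) -BB det_mulmx det_tr.
  by move=> /eqP; rewrite sqrf_eq1 => /orP[] /eqP ->; rewrite ?normrN normr1 invr1 mul1r.
have xE x : x *m (B *m invmx M) + p *m invmx M = (p + x *m B) *m invmx M.
  by rewrite mulmxA addrC mulmxDl.
by apply/seteqP; split => x /=; rewrite /cube /= xE => /parE.
Qed.

(** * Convex hulls and simplices *)

Lemma convex_setP (R : realType) (k : nat) (A : set 'rV[R]_k) :
  @convex_set R 'rV[R]_k A <->
  forall x y t, A x -> A y -> 0 <= t <= 1 -> A (t *: x + (1 - t) *: y).
Proof.
split=> [cA x y t Ax Ay /andP[t0 t1]|cA x y t /set_mem Ax /set_mem Ay].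
  by have := cA x y (Itv01 t0 t1) (mem_set Ax) (mem_set Ay); move/set_mem.
apply/mem_set; apply: (cA _ _ t%:num) => //.
by apply/andP; split.
Qed.

Lemma convex_set_sum (R : realType) (k n : nat) (A : set 'rV[R]_k)
    (p : 'I_n -> 'rV[R]_k) (c : 'I_n -> R) :
  @convex_set R 'rV[R]_k A -> (forall i, A (p i)) -> (forall i, 0 <= c i) ->
  \sum_i c i = 1 -> A (\sum_i c i *: p i).
Proof.
move=> /convex_setP cA; elim: n p c => [|n IH] p c Ap c0.
  by rewrite big_ord0 => /esym/eqP; rewrite oner_eq0.
rewrite !big_ord_recl => c1.
(* The other weights are renormalized by [1 - c ord0]; when this is zero they all vanish instead. *)
have [c01|c01] := eqVneq (c ord0) 1.
  have /psumr_eq0P s0 : \sum_i c (lift ord0 i) = 0 by rewrite c01 in c1; lra.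
  rewrite [X in _ + X]big1 ?c01 ?scale1r ?addr0// => i _.
  by rewrite s0 ?scale0r.
have s0 : 0 <= \sum_i c (lift ord0 i) by apply: sumr_ge0.
have t0 : 1 - c ord0 != 0 by rewrite subr_eq0 eq_sym.
have -> : \sum_(i < n) c (lift ord0 i) *: p (lift ord0 i) =
    (1 - c ord0) *: \sum_(i < n) (c (lift ord0 i) / (1 - c ord0)) *: p (lift ord0 i).
  by rewrite scaler_sumr; apply: eq_bigr => i _; rewrite scalerA mulrCA mulfV// mulr1.
apply: cA => //; last by rewrite c0 /=; lra.
apply: IH => // [i|]; first by rewrite divr_ge0//; lra.
by rewrite -mulr_suml -c1 addrAC subrr add0r mulfV// -(addKr (c ord0) (\sum_i _)) c1 addrC.
Qed.

Lemma convex_hull_simplex (R : realType) (d k : nat) (v : 'rV[R]_k) (W : 'M[R]_(d, k)) :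
  convex_hull ([set v] `|` range (fun i => v + row i W)) =
  [set v + c *m W | c in @corner_simplex R d 1].
Proof.
apply/seteqP; split.
  apply: smallest_sub.
    apply/convex_setP => _ _ t [c [c0 c1] <-] [c' [c'0 c'1] <-] /andP[t0 t1].
    exists (t *: c + (1 - t) *: c'); last first.
      rewrite mulmxDl -!scalemxAl !scalerDr addrACA -scalerDl.
      by rewrite subrKC scale1r.
    split=> [i|]; first by rewrite !mxE addr_ge0// mulr_ge0// subr_ge0.
    under eq_bigr do rewrite !mxE.
    rewrite big_split /= -!mulr_sumr; nra.
  move=> _ [->|[i _ <-]].
    exists 0; last by rewrite mul0mx addr0.
    by split => [i|]; rewrite ?big1// => *; rewrite mxE.
  exists (delta_mx 0 i); last by rewrite -rowE.
  split => [j|]; first by rewrite mxE ler0n.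
  rewrite (bigD1 i)//= big1 => [|j ji]; first by rewrite mxE !eqxx addr0.
  by rewrite mxE (negbTE ji) andbF.
move=> _ [c [c0 c1] <-] A [cA vA]; set s := \sum_i c 0 i in c1.
pose p i := if unlift ord0 i is Some j then v + row j W else v.
(* Barycentric weights: the base vertex [v] receives what the edge coefficients leave over. *)
pose t (i : 'I_d.+1) := if unlift ord0 i is Some j then c 0 j else 1 - s.
have -> : v + c *m W = \sum_i t i *: p i.
  rewrite big_ord_recl /t /p unlift_none; under eq_bigr do rewrite liftK.
  under eq_bigr do rewrite scalerDr.
  rewrite big_split /= -scaler_suml addrA -scalerDl subrK scale1r; congr (_ + _).
  by rewrite mulmx_sum_row.
apply: convex_set_sum => // [i|i|].
- by rewrite /p; case: unlift => [j|]; apply: vA; [right; exists j|left].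
- by rewrite /t; case: unlift => [j|]; rewrite ?subr_ge0.
rewrite big_ord_recl /t unlift_none; under eq_bigr do rewrite liftK.
by rewrite subrK.
Qed.

Lemma is_simplex_convex_hull (R : realType) (d k : nat) (v : 'rV[R]_k)
    (W : 'M[R]_(d, k)) : row_free W ->
  is_simplex d (convex_hull ([set v] `|` range (fun i => v + row i W))).
Proof.
move=> fW.
pose p i := if unlift ord0 i is Some j then v + row j W else v.
exists p; split.
  move=> c; rewrite !big_ord_recl => c0.
  rewrite /p unlift_none; under eq_bigr do rewrite liftK scalerDr.
  rewrite big_split /= -scaler_suml addrA -scalerDl c0 scale0r add0r => s0.
  have cE i : c (lift ord0 i) = 0.
    have : \row_i c (lift ord0 i) = 0.
      apply: (row_free_inj fW); rewrite mul0mx mulmx_sum_row -[RHS]s0.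
      by apply: eq_bigr => j _; rewrite mxE.
    by move/rowP/(_ i); rewrite !mxE.
  move=> i; case: (unliftP ord0 i) => [j|] ->; first exact: cE.
  by move: c0; rewrite big1 ?addr0.
congr convex_hull; apply/seteqP; split => x.
  move=> [->|[i _ <-]]; first by exists ord0 => //; rewrite /p unlift_none.
  by exists (lift ord0 i) => //; rewrite /p liftK.
by move=> [i _ <-]; rewrite /p; case: unlift => [j|]; [right; exists j|left].
Qed.

Lemma det_gram_gt0 (R : realType) (d k : nat) (W : 'M[R]_(d, k)) :
  row_free W -> 0 < \det (W *m W^T).
Proof.
move=> fW; have [B [Y [BB WE]]] := orthonormal_factor fW.
have uY : Y \in unitmx.
  rewrite -row_free_unit /row_free eqn_leq rank_leq_row /=.
  by rewrite -{1}(eqP fW) WE mxrankM_maxl.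
rewrite WE trmx_mul mulmxA -(mulmxA Y) BB mulmx1 det_mulmx det_tr -expr2.
by rewrite lt_def sqrf_eq0 sqr_ge0 -unitfE -unitmxE uY.
Qed.

(** By orthogonality, [col_mx P N] times its own transpose is block diagonal, and times the
    transpose of [col_mx P F] it is block triangular. Eliminating [det (col_mx P N)] and cancelling
    the positive [det (P *m P^T)] gives the identity. *)
Lemma det_gram_complement (R : realType) (a b : nat) (P : 'M[R]_(a, a + b))
    (N F : 'M[R]_(b, a + b)) :
  row_free P -> P *m N^T = 0 ->
  \det (col_mx P F) ^+ 2 * \det (N *m N^T) =
    \det (P *m P^T) * \det (N *m F^T) ^+ 2.
Proof.
move=> fP PN.
have NP : N *m P^T = 0 by apply: trmx_inj; rewrite trmx_mul trmxK PN trmx0.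
have XX : \det (col_mx P N) ^+ 2 = \det (P *m P^T) * \det (N *m N^T).
  by rewrite expr2 -{2}[\det _]det_tr -det_mulmx tr_col_mx mul_col_row PN NP det_ublock.
have XY : \det (col_mx P N) * \det (col_mx P F) = \det (P *m P^T) * \det (N *m F^T).
  by rewrite -[\det (col_mx P F)]det_tr -det_mulmx tr_col_mx mul_col_row NP det_ublock.
apply: (mulfI (lt0r_neq0 (det_gram_gt0 fP))).
by rewrite mulrCA -XX [RHS]mulrA -expr2 -!exprMn mulrC XY.
Qed.

(** * The cone and its polar dual *)

(** Expanding along the row [x], the sign and the minors combine into cofactors, so the facet
    normals are the columns of the adjugate. *)
Lemma dotp_facet_normal (R : realType) (n : nat) (e : 'I_n.+1 -> 'rV[R]_n.+1)
    (j : 'I_n.+1) (x : 'rV[R]_n.+1) :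
  dotp x (facet_normal e j) = (x *m \adj (\matrix_i e i)) 0 j.
Proof.
rewrite dotpZr dotp_cross (expand_det_row _ ord0) mulr_sumr mxE; apply: eq_bigr => i _.
rewrite !mxE; case: splitP => // k _; rewrite ord1 mulrCA; congr (_ * _).
rewrite /cofactor add0n mulrA -exprD; congr (_ * \det _).
apply/matrixP => a b; rewrite !mxE.
by case: splitP => [[[|//] ? //]|k' [] /val_inj <-]; rewrite !mxE.
Qed.

(** List each set followed by its complement and match entries by position. This is used to move [I]
    into standard slots. *)
Lemma perm_imset (T : finType) (A B : {set T}) :
  #|A| = #|B| -> exists s : {perm T}, B = s @: A.
Proof.
move=> AB; pose u := enum A ++ enum (~: A); pose w := enum B ++ enum (~: B).
have uniq_enumC (X : {set T}) : uniq (enum X ++ enum (~: X)).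
  by rewrite cat_uniq !enum_uniq andbT; apply/hasPn => x; rewrite !mem_enum inE.
have mem_enumC (X : {set T}) x : x \in enum X ++ enum (~: X).
  by rewrite mem_cat !mem_enum inE orbN.
have suw : size u = size w.
  by rewrite !size_cat -!cardE !cardsC.
pose f x := nth x w (index x u).
have ux x : (index x u < size w)%N by rewrite -suw index_mem mem_enumC.
have f_inj : injective f.
  move=> x y; rewrite /f (set_nth_default y) // => /eqP.
  rewrite nth_uniq ?uniq_enumC// => /eqP xy.
  by rewrite -(nth_index x (mem_enumC A x)) -/u xy nth_index ?mem_enumC.
exists (perm f_inj); apply/esym/eqP; rewrite eqEcard card_imset; last exact: perm_inj.
rewrite AB leqnn andbT.
apply/fintype.subsetP => _ /imsetP[x xA ->]; rewrite permE /f.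
have xi : (index x u < size (enum B))%N.
  by rewrite -cardE -AB cardE /u index_cat mem_enum xA index_mem mem_enum.
by rewrite nth_cat xi -mem_enum mem_nth.
Qed.

(** * Edge matrices of the two simplices and the ratio of their Gram determinants *)

Section dual_volumes.
Context (R : realType) (m b : nat).
Local Notation k := (m.+1 + b)%N.
Variables (e : 'I_k -> 'rV[R]_k) (v0 : 'rV[R]_k) (tq : 'I_k -> 'rV[R]_k).
Variables (a : 'I_k -> R) (s : {perm 'I_k}).
Hypothesis a_neq0 : forall j, a j != 0.
Hypothesis v0E : v0 = \sum_i a i *: e i.
Hypothesis e_tq : forall i j, dotp (e i) (tq j) = (i == j)%:R / a j.
Hypothesis unit_e : \matrix_i e i \in unitmx.

(* The slot lshift b ord0 of the ordering s holds a distinguished element of J,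
   the other slots on the left hold I and those on the right the rest of J. *)
Definition cone_edges : 'M[R]_(m.+1, k) :=
  \matrix_(i < m.+1) if unlift ord0 i is Some i' then e (s (lshift b (lift ord0 i')))
                     else - v0.

Definition dual_edges : 'M[R]_(b, k) :=
  \matrix_(j < b) (tq (s (rshift m.+1 j)) - tq (s (lshift b ord0))).

Definition free_rays : 'M[R]_(b, k) := \matrix_(j < b) e (s (rshift m.+1 j)).

Lemma dotp_v0_tq j : dotp v0 (tq j) = 1.
Proof.
rewrite dotpC v0E dotp_sumr (bigD1 j)//= big1 => [|i ij]; rewrite dotpC e_tq.
  by rewrite eqxx mul1r divff// addr0.
by rewrite (negbTE ij) mul0r mulr0.
Qed.

(** All [tq j] pair to [1] with [v0], so their differences are orthogonal to it; a ray indexed by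
    [I] is orthogonal to every [tq j] with [j] in [J]. *)
Lemma cone_dual_orthogonal : cone_edges *m dual_edges^T = 0.
Proof.
apply/matrixP => i j; rewrite [RHS]mxE.
transitivity (dotp (row i cone_edges) (row j dual_edges)).
  rewrite -mulmx_tr_dotp -row_mul tr_row colE mulmxA -colE !mxE.
  by apply: eq_bigr => h _; rewrite !mxE.
rewrite !rowK dotpBr; case: unliftP => [i' _|_].
  rewrite !e_tq !(inj_eq perm_inj) eq_lrshift (inj_eq (@lshift_inj _ _)).
  by rewrite eq_sym (negbTE (neq_lift _ _)) !mul0r subrr.
by rewrite ![dotp (- v0) _]dotpC -scaleN1r !dotpZr ![dotp _ v0]dotpC !dotp_v0_tq subrr.
Qed.

Lemma dual_free_diag :
  dual_edges *m free_rays^T = diag_mx (\row_j (a (s (rshift m.+1 j)))^-1).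
Proof.
apply/matrixP => i j; rewrite [RHS]mxE mxE.
transitivity (dotp (e (s (rshift m.+1 j)))
    (tq (s (rshift m.+1 i)) - tq (s (lshift b ord0)))).
  by apply: eq_bigr => h _; rewrite !mxE mulrC.
rewrite dotpBr !e_tq !(inj_eq perm_inj) eq_rlshift mul0r subr0.
by rewrite (inj_eq (@rshift_inj _ _)) eq_sym mxE mulrC mulr_natr.
Qed.

(** In the basis reordered by [s] the rows are those of the identity, except the first, which holds
    the coordinates of [- v0]. This [T] is triangular, and squaring removes the sign of [s]. *)
Lemma det_cone_free :
  \det (col_mx cone_edges free_rays) ^+ 2 =
  (a (s (lshift b ord0)) * \det (\matrix_i e i)) ^+ 2.
Proof.
pose T : 'M[R]_k := \matrix_(i, j) if i == lshift b ord0 then - a (s j) else (i == j)%:R.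
have -> : col_mx cone_edges free_rays = T *m row_perm s (\matrix_i e i).
  apply/row_matrixP => i; rewrite row_mul mulmx_sum_row.
  under eq_bigr => j _.
    rewrite (_ : row j _ = e (s j)); last by apply/rowP => h; rewrite !mxE.
    rewrite mxE mxE; over.
  have [->|i0] := eqVneq i (lshift b ord0).
    rewrite rowKu rowK unlift_none v0E (reindex_inj (@perm_inj _ s)) /= -sumrN.
    by apply: eq_bigr => j _; rewrite scaleNr.
  rewrite (bigD1 i)//= eqxx scale1r big1 ?addr0 => [|j ji]; last first.
    by rewrite eq_sym (negbTE ji) scale0r.
  rewrite -(splitK i) in i0 *; case: (fintype.split i) i0 => j /= i0.
    rewrite rowKu rowK; case: unliftP => [j' ->//|j0].
    by rewrite j0 eqxx in i0.
  by rewrite rowKd rowK.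
rewrite det_mulmx row_permE det_mulmx det_perm !exprMn sqrr_sign mul1r; congr (_ * _).
rewrite -det_tr det_trig; last first.
  apply/is_trig_mxP => i j ij; rewrite !mxE.
  case: ifP => [/eqP j0|_]; first by rewrite j0 in ij.
  by rewrite -val_eqE /= gtn_eqF.
rewrite (bigD1 (lshift b ord0))//= !mxE eqxx big1 ?mulr1 ?sqrrN// => i i0.
by rewrite !mxE (negbTE i0) eqxx.
Qed.

Lemma row_free_cone_edges : row_free cone_edges.
Proof.
have uY : col_mx cone_edges free_rays \in unitmx.
  rewrite unitmxE unitfE -sqrf_eq0 det_cone_free sqrf_eq0 mulf_eq0 negb_or a_neq0.
  by rewrite -unitfE -unitmxE.
apply: inj_row_free => x xP.
have : row_mx x 0 *m col_mx cone_edges free_rays = 0.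
  by rewrite mul_row_col xP mul0mx addr0.
move/eqP; rewrite mulmx_free_eq0 ?row_free_unit// => /eqP /(congr1 (@lsubmx R 1 m.+1 b)).
by rewrite row_mxKl linear0.
Qed.

Lemma row_free_dual_edges : row_free dual_edges.
Proof.
apply: inj_row_free => x xN.
have : x *m (dual_edges *m free_rays^T) = 0 by rewrite mulmxA xN mul0mx.
rewrite dual_free_diag => /rowP h; apply/rowP => j; move: (h j).
rewrite mul_mx_diag !mxE => /eqP; rewrite mulf_eq0 invr_eq0 (negbTE (a_neq0 _)) orbF.
by move/eqP.
Qed.

Lemma sqrt_gram_ratio :
  Num.sqrt (\det (dual_edges *m dual_edges^T)) =
  Num.sqrt (\det (cone_edges *m cone_edges^T)) /
    (`|\det (\matrix_i e i)| * `|a (s (lshift b ord0))| *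
     \prod_(j < b) `|a (s (rshift m.+1 j))|).
Proof.
have := det_gram_complement free_rays row_free_cone_edges cone_dual_orthogonal.
rewrite det_cone_free dual_free_diag det_diag.
set gN := \det (dual_edges *m _); set gP := \det (cone_edges *m _).
set D := \det _; set a0 := a _; pose p := \prod_(j < b) (a (s (rshift m.+1 j)))^-1.
rewrite (eq_bigr _ (fun j _ => mxE _ _ _ _)) -/p => h.
have D0 : D != 0 by rewrite -unitfE -unitmxE.
have pE : \prod_(j < b) `|a (s (rshift m.+1 j))| = `|p|^-1.
  by rewrite normr_prod -prodfV; apply: eq_bigr => j _; rewrite normfV invrK.
have gP0 : 0 < gP by exact: det_gram_gt0 row_free_cone_edges.
(* The determinant identity solved for the dual Gram determinant; the factor multiplying [gP] is a
   square, so its root is an absolute value. *)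
have -> : gN = gP * (p / (a0 * D)) ^+ 2.
  rewrite expr_div_n mulrA -h mulrC mulKf// sqrf_eq0 mulf_neq0//; exact: a_neq0.
rewrite sqrtrM ?ltW// sqrtr_sqr pE normrM normfV normrM; congr (_ * _).
by rewrite !invfM invrK [RHS]mulrC [X in _ * X = _]mulrC.
Qed.

End dual_volumes.

(** * The cone in the basis of its rays *)

Section simplicial_cone.
Context (R : realType) (n : nat) (v0 : 'rV[R]_n.+1) (e : 'I_n.+1 -> 'rV[R]_n.+1).
Local Notation M := (\matrix_i e i).
Hypothesis unit_e : M \in unitmx.

Definition coef (x : 'rV[R]_n.+1) (j : 'I_n.+1) : R := (x *m invmx M) 0 j.

Lemma coef_sum (x : 'rV[R]_n.+1) : x = \sum_j coef x j *: e j.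
Proof.
rewrite -[LHS](mulmxKV unit_e) mulmx_sum_row; apply: eq_bigr => j _.
by rewrite rowK.
Qed.

Lemma coef_comb (mu : 'I_n.+1 -> R) j : coef (\sum_i mu i *: e i) j = mu j.
Proof.
have -> : \sum_i mu i *: e i = (\row_i mu i) *m M.
  by rewrite mulmx_sum_row; apply: eq_bigr => i _; rewrite rowK mxE.
by rewrite /coef mulmxK// mxE.
Qed.

Lemma coefD x y j : coef (x + y) j = coef x j + coef y j.
Proof. by rewrite /coef mulmxDl mxE. Qed.

Lemma coefZ t x j : coef (t *: x) j = t * coef x j.
Proof. by rewrite /coef -scalemxAl mxE. Qed.

Lemma coef_e i j : coef (e i) j = (i == j)%:R.
Proof.
by rewrite -[e i](rowK e) /coef -row_mul mulmxV// row1 mxE eqxx eq_sym.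
Qed.

Lemma cone_coefP v : cone v0 e v <-> forall j, coef v0 j <= coef v j.
Proof.
split=> [[_ [mu [mu0 ->]] <-] j|h]; first by rewrite coefD coef_comb lerDl.
exists (v - v0); last by rewrite addrC subrK.
exists (coef (v - v0)); split; last exact: coef_sum.
by move=> j; rewrite coefD -scaleN1r coefZ mulN1r subr_ge0.
Qed.

Lemma convex_cone : @convex_set R 'rV[R]_n.+1 (cone v0 e).
Proof.
apply/convex_setP => x y t /cone_coefP hx /cone_coefP hy /andP[t0 t1].
apply/cone_coefP => j; rewrite coefD !coefZ; have := hx j; have := hy j; nra.
Qed.

(** A small negative multiple of [e j] still lies in the cone, and its [j]-th coefficient bounds
    that of the apex from above. *)
Lemma apex_coef_lt0 : interior (cone v0 e) 0 -> forall j, coef v0 j < 0.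
Proof.
move=> int0 j.
have cvg0 : (fun t : R => t *: e j) t @[t --> (0 : R)] --> (0 : 'rV[R]_n.+1).
  rewrite -[X in _ --> X](scale0r (e j)); apply: cvgZr_tmp; exact: cvg_id.
have /nbhs_ballP[/= eps eps0 h] := cvg0 _ int0.
have /h/cone_coefP/(_ j) : ball (0 : R) eps (- (eps / 2)).
  rewrite /ball /= sub0r opprK ger0_norm ?divr_ge0 ?ltW//.
  by rewrite ltr_pdivrMr// ltr_pMr// ltr1n.
rewrite coefZ coef_e eqxx mulr1 => /le_lt_trans; apply.
by rewrite oppr_lt0 divr_gt0.
Qed.

Lemma dotp_facet_coef j x : dotp x (facet_normal e j) = \det M * coef x j.
Proof.
rewrite dotp_facet_normal /coef /invmx unit_e -scalemxAr [in RHS]mxE mulrA.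
by rewrite mulfV ?mul1r// -unitfE -unitmxE.
Qed.

Hypothesis apex_lt0 : forall j, coef v0 j < 0.
Variable tq : 'I_n.+1 -> 'rV[R]_n.+1.
Hypothesis tqE : forall j,
  tq j = (dotp v0 (facet_normal e j))^-1 *: facet_normal e j.

(** The factor [\det M] cancels in the normalization, leaving the dual basis of [e] rescaled by the
    apex coefficients. *)
Lemma dotp_dual_vertex x j : dotp x (tq j) = coef x j / coef v0 j.
Proof.
have D0 : \det M != 0 by rewrite -unitfE -unitmxE.
rewrite tqE dotpZr !dotp_facet_coef.
by rewrite invfM mulrACA mulVf// mul1r mulrC.
Qed.

Lemma dotp_dual_comb (c : 'rV[R]_n.+1) x :
  dotp x (c *m \matrix_i tq i) = \sum_j c 0 j * (coef x j / coef v0 j).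
Proof.
rewrite mulmx_sum_row dotp_sumr; apply: eq_bigr => j _.
by rewrite rowK dotp_dual_vertex.
Qed.

Lemma cone_halfspaces :
  cone v0 e = [set v | forall j, dotp v (tq j) <= dotp v0 (tq j)].
Proof.
apply/seteqP; split => v /=.
  move=> /cone_coefP h j; rewrite !dotp_dual_vertex.
  by rewrite ler_nM2r ?invr_lt0.
move=> h; apply/cone_coefP => j; have := h j; rewrite !dotp_dual_vertex.
by rewrite ler_nM2r ?invr_lt0.
Qed.

(** Testing [p] on the apex and far along the rays gives [dotp p v0 <= 1] and [dotp p (e j) <= 0],
    which are the conditions on the weights of [p] in the [tq j]. Conversely, on the cone every
    ratio [coef v j / coef v0 j] is at most [1]. *)
Lemma polar_dual_cone :
  polar_dual (cone v0 e) = convex_hull ([set 0] `|` range tq).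
Proof.
have -> : [set 0] `|` range tq =
    [set 0] `|` range (fun j => 0 + row j (\matrix_i tq i)).
  by congr (_ `|` _); apply: eq_imagel => j _; rewrite add0r rowK.
rewrite convex_hull_simplex; apply/seteqP; split => p.
  move=> hp.
  have hp0 : dotp p v0 <= 1 by apply: hp; apply/cone_coefP.
  have hpe j : dotp p (e j) <= 0.
    rewrite leNgt; apply/negP => pe0.
    (* With this [t], the pairing of [p] with [v0 + t *: e j] is [1 + dotp p (e j)], which exceeds
       [1]. *)
    pose t := (1 - dotp p v0) / dotp p (e j) + 1.
    have t0 : 0 <= t by rewrite addr_ge0// divr_ge0 ?subr_ge0// ltW.
    have : cone v0 e (v0 + t *: e j).
      by apply/cone_coefP => i; rewrite coefD coefZ coef_e lerDl mulr_ge0.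
    move=> /hp; rewrite dotpDr dotpZr /t mulrDl divfK ?gt_eqF// mul1r.
    lra.
  (* Forced by pairing with [e j], since [tq j] pairs with it to the inverse of [coef v0 j]. The
     weights add up to [dotp p v0]. *)
  pose c : 'rV[R]_n.+1 := \row_j (dotp p (e j) * coef v0 j).
  exists c; first split.
  - by move=> j; rewrite mxE mulr_le0// ltW.
  - rewrite (le_trans _ hp0)// le_eqVlt; apply/orP; left; apply/eqP.
    rewrite [in RHS](coef_sum v0) dotp_sumr.
    by apply: eq_bigr => j _; rewrite mxE mulrC.
  have free_tr : row_free M^T by rewrite row_free_unit unitmx_tr.
  rewrite add0r; apply: (row_free_inj free_tr).
  have row_e (x : 'rV[R]_n.+1) j : (x *m M^T) 0 j = dotp x (e j).
    by rewrite mxE; apply: eq_bigr => i _; rewrite !mxE.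
  apply/rowP => j; rewrite !row_e dotpC dotp_dual_comb (bigD1 j)//= big1 => [|i ij].
    by rewrite mxE coef_e eqxx addr0 mulrA mulr1 mulfK ?lt_eqF.
  by rewrite coef_e eq_sym (negbTE ij) mul0r mulr0.
move=> [c [c0 c1] <-] v /cone_coefP hv; rewrite add0r dotpC.
rewrite dotp_dual_comb.
apply: le_trans c1; apply: ler_sum => j _; rewrite ler_piMr//.
by rewrite ler_ndivrMr// mul1r.
Qed.

End simplicial_cone.

(* k = n.+1, since 0 <= m < k forces k >= 1. *)
Theorem theorem1p2 (R : realType) (n : nat) (v0 : 'rV[R]_n.+1)
    (e : 'I_n.+1 -> 'rV[R]_n.+1)
    (e_lin_indep : row_free (\matrix_(i < n.+1) e i))
    (C : set 'rV[R]_n.+1) (CE : C = cone v0 e) (int0 : interior C 0)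
    (q : 'I_n.+1 -> 'rV[R]_n.+1) (qE : forall j, q j = facet_normal e j)
    (tq : 'I_n.+1 -> 'rV[R]_n.+1)
    (tqE : forall j, tq j = (dotp v0 (q j))^-1 *: q j)
    (m : nat) (m_lt : (m < n.+1)%N) (I : {set 'I_n.+1}) (cardI : #|I| = m)
    (J : {set 'I_n.+1}) (JE : J = finset.setC I) (l : nat) (lE : l = #|J|)
    (S Delta E : set 'rV[R]_n.+1)
    (SE : S = convex_hull ([set 0; v0] `|` [set v0 + e i | i in [set` I]]))
    (DeltaE : Delta = convex_hull [set tq j | j in [set` J]])
    (EE : E = parallelepiped e) :
  (forall j, dotp v0 (q j) != 0) /\
  C = [set v | forall j, dotp v (tq j) <= dotp v0 (tq j)] /\
  polar_dual C = convex_hull ([set 0] `|` range tq) /\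
  (is_simplex m.+1 S /\ S `<=` C) /\
  (is_simplex l.-1 Delta /\ Delta `<=` polar_dual C) /\
  fine (vol l.-1 Delta) / fine (vol m.+1 S) =
    (m.+1)`!%:R / (l.-1)`!%:R *
    (fine (vol n.+1 E) ^+ l.-1 / \prod_(j in J) `|dotp v0 (q j)|).
Proof.
have unit_e : \matrix_i e i \in unitmx by rewrite -row_free_unit.
have a_lt0 : forall j, coef e v0 j < 0 by apply: apex_coef_lt0 => //; rewrite -CE.
have D0 : \det (\matrix_i e i) != 0 by rewrite -unitfE -unitmxE.
have a0 j : coef e v0 j != 0 by rewrite lt_eqF.
have v0q j : dotp v0 (q j) = \det (\matrix_i e i) * coef e v0 j.
  by rewrite qE dotp_facet_coef.
have tqE' j : tq j = (dotp v0 (facet_normal e j))^-1 *: facet_normal e j.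
  by rewrite tqE qE.
have polE : polar_dual C = convex_hull ([set 0] `|` range tq).
  by rewrite CE; exact: polar_dual_cone.
split; first by move=> j; rewrite v0q mulf_neq0.
split; first by rewrite CE; exact: cone_halfspaces.
split; first exact: polE.
have SC : S `<=` C.
  rewrite CE SE; apply: smallest_sub; first exact: convex_cone.
  move=> _ [[->|->]|[i _ <-]].
  - by rewrite -CE; exact: nbhs_singleton int0.
  - exact/cone_coefP.
  - by apply/cone_coefP => // j; rewrite coefD coef_e// lerDl ler0n.
have DC : Delta `<=` polar_dual C.
  rewrite polE DeltaE => x Dx A [cA hA]; apply: Dx; split => // _ [j _ <-].
  by apply: hA; right; exists j.
(* [b] is [l - 1]. Rewriting [n] as [m + b] lets the edge matrices be stacked into a square one. *)
pose b := (n - m)%N.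
have lE' : l = b.+1.
  by rewrite lE JE cardsCs finset.setCK cardI card_ord /b subSn.
have nE : n = (m + b)%N by rewrite /b subnKC.
rewrite lE' /=; clearbody b; subst n.
(* The standard slots for [I]: the left block without its first slot. The permutation [s] carries
   [K] onto [I], hence the remaining slots onto [J]. *)
pose K := [set lshift b (lift ord0 i) | i in [set: 'I_m]]%SET.
have cardK : #|K| = #|I|.
  rewrite card_imset ?cardsT ?card_ord//.
  by move=> i j /lshift_inj/lift_inj.
have [s IE] := perm_imset cardK.
have v0E : v0 = \sum_i coef e v0 i *: e i by exact: coef_sum.
have e_tq i j : dotp (e i) (tq j) = (i == j)%:R / coef e v0 j.
  by rewrite (dotp_dual_vertex unit_e tqE') coef_e.
have sI i : (s i \in I) = (i \in K) by rewrite IE mem_imset//; exact: perm_inj.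
have K0 : lshift b ord0 \notin K.
  by apply/imsetP => -[i _ /lshift_inj/eqP]; rewrite (negbTE (neq_lift _ _)).
have KR j : rshift m.+1 j \notin K.
  by apply/imsetP => -[i _ /eqP]; rewrite eq_rlshift.
have KL (i : 'I_m) : lshift b (lift ord0 i) \in K by apply: imset_f; rewrite inE.
(* The base vertex is [v0]; the origin is reached along the edge [- v0]. *)
have SE' : S = convex_hull ([set v0] `|` range (fun i => v0 + row i (cone_edges e v0 s))).
  rewrite SE; congr convex_hull; apply/seteqP; split => x.
    move=> [[->|->]|[i /= iI <-]]; [right|by left|right].
      by exists ord0 => //; rewrite rowK unlift_none subrr.
    move: iI; rewrite /= IE => /imsetP[_ /imsetP[i' _ ->] ->].
    by exists (lift ord0 i') => //; rewrite rowK liftK.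
  move=> [->|[i _ <-]]; first by left; right.
  rewrite rowK; case: unlift => [i'|]; last by left; left; rewrite subrr.
  by right; exists (s (lshift b (lift ord0 i'))) => //=; rewrite sI.
have DE' : Delta = convex_hull ([set tq (s (lshift b ord0))] `|`
    range (fun j => tq (s (lshift b ord0)) + row j (dual_edges tq s))).
  rewrite DeltaE; congr convex_hull; apply/seteqP; split => x.
    move=> [j /=]; rewrite JE -(permKV s j) finset.in_setC sI => + <-.
    rewrite -(splitK (s^-1%g j)); case: fintype.split => i /=; last first.
      by move=> _; right; exists i => //; rewrite rowK addrC subrK.
    case: (unliftP ord0 i) => [i'|] ->; first by rewrite KL.
    by move=> _; left.
  move=> [->|[j _ <-]].
    by exists (s (lshift b ord0)) => //=; rewrite JE finset.in_setC sI.
  exists (s (rshift m.+1 j)); first by rewrite /= JE finset.in_setC sI.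
  by rewrite rowK addrC subrK.
have fP := row_free_cone_edges s a0 v0E unit_e.
have fN := row_free_dual_edges s a0 e_tq.
split; first by split => //; rewrite SE'; exact: is_simplex_convex_hull.
split; first by split => //; rewrite DE'; exact: is_simplex_convex_hull.
rewrite SE' DE' EE !convex_hull_simplex !vol_simplex// vol_parallelepiped//=.
rewrite (sqrt_gram_ratio s a0 v0E e_tq unit_e).
(* Reindexed by [s], the left block contributes only its first slot and the right block all [b]
   slots, each factor carrying one [|det|]. *)
have -> : \prod_(j in J) `|dotp v0 (q j)| = `|\det (\matrix_i e i)| ^+ b.+1 *
    (`|coef e v0 (s (lshift b ord0))| * \prod_(j < b) `|coef e v0 (s (rshift m.+1 j))|).
  have sJ i : (s i \in J) = (i \notin K) by rewrite JE finset.in_setC sI.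
  rewrite (reindex_inj (@perm_inj _ s)) big_mkcond (@big_split_ord _ _ _ m.+1 b) /=.
  rewrite big_ord_recl sJ K0 [X in _ * X * _]big1 => [|i _]; last by rewrite sJ KL.
  rewrite mulr1 v0q normrM exprS -!mulrA; congr (_ * _); rewrite mulrCA; congr (_ * _).
  under eq_bigr do rewrite sJ KR v0q normrM.
  by rewrite big_split /= prodr_const card_ord.
have x0 : Num.sqrt (\det (cone_edges e v0 s *m (cone_edges e v0 s)^T)) != 0.
  by rewrite sqrtr_eq0 -ltNge det_gram_gt0.
have y0 : `|coef e v0 (s (lshift b ord0))| != 0 by rewrite normr_eq0.
have z0 : \prod_(j < b) `|coef e v0 (s (rshift m.+1 j))| != 0.
  by apply/prodf_neq0 => j _; rewrite normr_eq0.
have d0 : `|\det (\matrix_i e i)| != 0 by rewrite normr_eq0.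
have f0 k : k`!%:R != 0 :> R by rewrite pnatr_eq0 -lt0n fact_gt0.
by rewrite exprS; field; rewrite z0 y0 expf_neq0// d0 !f0 x0.
Qed.
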